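(* Let $(\Psi_u,\Psi_l,\mathcal{S},\mathcal{T},\epsilon)$ be a solution of the SOS program (P) (given in the context) for a fixed degree $d$, and let $V_u=-\lambda\log\Psi_l$. Then $V_u$ (regarded as a time-independent function) is a stochastic control Lyapunov function for the system $dx_t=(f(x_t)+G(x_t)u_t)\,dt+B(x_t)\,d\omega_t$.
   Context: Setting. $\Omega=\{x\in\mathbb{R}^n: g_i(x)\ge 0,\ i=1,\dots,k\}$ with $g_i\in\mathbb{R}[x]$ is a compact basic closed semialgebraic set, $0\in\Omega$, and $\partial\Omega=\{x:\prod_{i=1}^m h_i(x)=0\}$, $h_i\in\mathbb{R}[x]$. The dynamics are $dx_t=(f(x_t)+G(x_t)u_t)\,dt+B(x_t)\,d\omega_t$ with $f,G,B$ having real polynomial entries, $f(0)=0$, $G(0)=0$, $B(0)=0$, and $\omega_t$ a multidimensional Brownian motion with covariance $\Sigma_\epsilon$. The cost is $J(x,u)=\mathbb{E}_{\omega_t}[\phi(x_T)+\int_0^T q(x_t)+\frac12u_t^TRu_t\,dt]$, where $T$ is the first time the state reaches the boundary of the domain or the origin, $R$ is symmetric positive definite, and $\phi,q$ are nonnegative polynomials, positive definite on $\Omega$ (zero at $0$, positive on $\Omega\setminus\{0\}$). The origin is treated as part of the boundary on which boundary data are imposed: $\phi(0)=0$, and $\phi>0$ on $\partial\Omega\setminus\{0\}$. There is $\lambda>0$ with $\lambda G R^{-1}G^T=B\Sigma_\epsilon B^T=:\Sigma(x)=\Sigma_t$. Notation. $\mathcal{L}(\Psi)=f^T\nabla_x\Psi+\frac12\mathrm{Tr}((\nabla_{xx}\Psi)\Sigma)$;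 $\psi=e^{-\phi/\lambda}$ on $\partial\Omega$. It is assumed that $0=-\frac1\lambda q\Psi+\mathcal{L}(\Psi)$ on $\Omega$, $\Psi=\psi$ on $\partial\Omega$, has a unique nontrivial viscosity solution $\Psi^*$, and that the HJB equation $0=q+(\nabla_xV)^Tf-\frac12(\nabla_xV)^TGR^{-1}G^T\nabla_xV+\frac12\mathrm{Tr}((\nabla_{xx}V)B\Sigma_\epsilon B^T)$ on $\Omega$, $V=\phi$ on $\partial\Omega$, has a unique nontrivial viscosity solution $V^*$, the value function $V^*=\min_uJ$; they satisfy $V^*=-\lambda\log\Psi^*$. $\mathbb{S}[x]$ is the set of sums of squares of real polynomials. $\Psi_l$ is understood to be positive so that its logarithm is defined. Operators. For a set $\{g_1\ge0,\dots,g_k\ge0\}=\Omega$ and $\mathcal{S}=\{s_\nu\in\mathbb{S}[x]:\nu\in\{0,1\}^k\}$, $\mathcal{D}(\Omega,\mathcal{S})=\sum_{\nu}s_\nu g_1^{\nu_1}\cdots g_k^{\nu_k}$. For a polynomial $p$ and $\mathcal{T}=\{t_1,\dots,t_m\}\subset\mathbb{R}[x]$, $\mathcal{B}(p,\partial\Omega,\mathcal{T})=\{p-t_ih_i:i=1,\dots,m\}$; $\mathcal{B}(\cdot)\in\mathbb{S}[x]$ means every element is in $\mathbb{S}[x]$ ($\psi$ being represented by a polynomial on $\partial\Omega$ when $\mathcal{B}$ is applied). SOS program (P): minimize $\epsilon$ over polynomials $\Psi_l,\Psi_u$, and $\mathcal{S}=(\mathcal{S}_1,\dots,\mathcal{S}_5)$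 (sets of SOS polynomials), $\mathcal{T}=(\mathcal{T}_1,\mathcal{T}_2,\mathcal{T}_3)$ (sets of polynomials), all of degree at most $d$, subject to: $-\frac1\lambda q\Psi_l+\mathcal{L}(\Psi_l)-\mathcal{D}(\Omega,\mathcal{S}_1)\in\mathbb{S}[x]$; $\frac1\lambda q\Psi_u-\mathcal{L}(\Psi_u)-\mathcal{D}(\Omega,\mathcal{S}_2)\in\mathbb{S}[x]$; $\epsilon-(\Psi_u-\Psi_l)-\mathcal{D}(\Omega,\mathcal{S}_3)\in\mathbb{S}[x]$; $\mathcal{B}(\Psi_l,\partial\Omega,\mathcal{T}_1)\in\mathbb{S}[x]$; $\mathcal{B}(\psi-\Psi_l,\partial\Omega,\mathcal{T}_2)\in\mathbb{S}[x]$; $\mathcal{B}(\Psi_u-\psi,\partial\Omega,\mathcal{T}_3)\in\mathbb{S}[x]$; for each coordinate $x^i$: $-\partial_{x^i}\Psi_l-\mathcal{D}(\Omega\cap\{x^i\ge0\},\mathcal{S}_4)\in\mathbb{S}[x]$ and $\partial_{x^i}\Psi_l-\mathcal{D}(\Omega\cap\{-x^i\ge0\},\mathcal{S}_5)\in\mathbb{S}[x]$; $\Psi_l(0)=1$. Stochastic control Lyapunov function (SCLF): a positive definite function $\mathcal{V}(x,t)\in\mathcal{C}^{2,1}$ (twice differentiable in $x$, once in $t$) on $\mathcal{O}=\Omega\times\{t>0\}$ such that $\mathcal{V}(0,t)=0$ and $\mathcal{V}(x,t)\ge\mu(|x|)$ for all $t>0$, for some $\mu\in\mathcal{K}$, and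 there exists $u(x,t)$ such that $L(\mathcal{V}(x,t))\le0$ for all $(x,t)\in\mathcal{O}\setminus\{(0,t)\}$, where $L(\mathcal{V})=\partial_t\mathcal{V}+(\nabla_x\mathcal{V})^T(f+Gu)+\frac12\mathrm{Tr}((\nabla_{xx}\mathcal{V})B\Sigma_\epsilon B^T)$. $\mathcal{K}$ is the set of continuous nondecreasing $\mu:\mathbb{R}_+\to\mathbb{R}_+$ with $\mu(0)=0$ and $\mu(r)>0$ for $r>0$. *)

(* Defs.v *)
From HB Require Import structures.
From mathcomp Require Import all_boot all_order all_algebra.
From mathcomp Require Import all_classical all_reals all_analysis.
(* mpoly's notations clash with those of mathcomp-analysis. *)
From mathcomp Require Import -(notations) mpoly.

Set Implicit Arguments.
Unset Strict Implicit.
Unset Printing Implicit Defensive.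

Import Order.TTheory GRing.Theory Num.Theory.
Import numFieldNormedType.Exports.

Local Open Scope classical_set_scope.
Local Open Scope ring_scope.

Section Polynomials.
Variables (R : realType) (n : nat).
Local Notation P := (mpoly n R).

Definition peval (p : P) (x : 'cV[R]_n) : R := meval (fun i => x i 0) p.

Definition pevalmx (a b : nat) (A : 'M[P]_(a, b)) (x : 'cV[R]_n) :
    'M[R]_(a, b) :=
  map_mx (fun p => peval p x) A.

Definition constmx (a b : nat) (A : 'M[R]_(a, b)) : 'M[P]_(a, b) :=
  map_mx (@mpolyC n R) A.

Definition xvar (i : 'I_n) : P := mpolyX R (mnm1 i).

(* The library's [mmeasure mdeg] is the total degree plus one, and 0 at 0. *)
Definition deg_le (d : nat) (p : P) : Prop := (mmeasure mdeg p <= d.+1)%N.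

Definition pgrad (p : P) : 'cV[P]_n := \col_i mderiv i p.
Definition phess (p : P) : 'M[P]_n := \matrix_(i, j) mderiv i (mderiv j p).

Definition sos (p : P) : Prop :=
  exists s : seq P, p = \sum_(a <- s) a ^+ 2.

Definition semialg (k : nat) (g : k.-tuple P) : set 'cV[R]_n :=
  [set x | forall i, 0 <= peval (tnth g i) x].

Definition zero_locus (m : nat) (h : m.-tuple P) : set 'cV[R]_n :=
  [set x | peval (\prod_(i < m) tnth h i) x = 0].

(* The index nu ranges over {0,1}^k. *)
Definition opD (k : nat) (g : k.-tuple P) (s : {ffun 'I_k -> bool} -> P) : P :=
  \sum_(nu : {ffun 'I_k -> bool}) s nu * \prod_(i < k) tnth g i ^+ nu i.

Definition opB_sos (m : nat) (h : m.-tuple P) (p : P) (t : 'I_m -> P) : Prop :=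
  forall i, sos (p - t i * tnth h i).

End Polynomials.

Section Calculus.
Variables (R : realType) (n : nat).

Definition eucl_norm (x : 'cV[R]_n) : R := Num.sqrt (\sum_i x i 0 ^+ 2).

Definition topo_boundary (A : set 'cV[R]_n) : set 'cV[R]_n :=
  closure A `\` interior A.

Definition pd_fun_on (A : set 'cV[R]_n) (v : 'cV[R]_n -> R) : Prop :=
  v 0 = 0 /\ forall x, A x -> x != 0 -> 0 < v x.

Definition pd_mx (M : 'M[R]_n) : Prop :=
  M^T = M /\ forall v : 'cV[R]_n, v != 0 -> 0 < (v^T *m M *m v) 0 0.

Definition psd_mx (M : 'M[R]_n) : Prop :=
  M^T = M /\ forall v : 'cV[R]_n, 0 <= (v^T *m M *m v) 0 0.

Definition partial (i : 'I_n) (v : 'cV[R]_n -> R) (x : 'cV[R]_n) : R :=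
  'D_(delta_mx i 0) v x.

Definition gradient (v : 'cV[R]_n -> R) (x : 'cV[R]_n) : 'cV[R]_n :=
  \col_i partial i v x.

Definition hessian (v : 'cV[R]_n -> R) (x : 'cV[R]_n) : 'M[R]_n :=
  \matrix_(i, j) partial i (partial j v) x.

Definition C2_on (U : set 'cV[R]_n) (v : 'cV[R]_n -> R) : Prop :=
  forall x, U x ->
    [/\ {for x, continuous v},
        forall i, derivable v x (delta_mx i 0)
               /\ {for x, continuous (partial i v)}
      & forall i j, derivable (partial j v) x (delta_mx i 0)
               /\ {for x, continuous (partial i (partial j v))}].

Definition time_derivative (V : 'cV[R]_n -> R -> R) (x : 'cV[R]_n) (t : R) : R :=
  derive1 (V x) t.

(* A need not be open: C^{2,1} on A x {t > 0} means C^{2,1} on U x {t > 0}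
   for some open neighbourhood U of A. *)
Definition C21_on (A : set 'cV[R]_n) (V : 'cV[R]_n -> R -> R) : Prop :=
  exists2 U : set 'cV[R]_n, open U /\ A `<=` U &
  forall x t, U x -> 0 < t ->
    [/\ {for (x, t), continuous (fun z => V z.1 z.2)},
        derivable (V x) t 1
          /\ {for (x, t), continuous (fun z => time_derivative V z.1 z.2)},
        forall i, derivable (V^~ t) x (delta_mx i 0)
          /\ {for (x, t), continuous (fun z => partial i (V^~ z.2) z.1)}
      & forall i j, derivable (partial j (V^~ t)) x (delta_mx i 0)
          /\ {for (x, t),
               continuous (fun z => partial i (partial j (V^~ z.2)) z.1)}].

(* Class K; only the values on [0, +oo[ are relevant. *)
Definition class_K (mu : R -> R) : Prop :=
  [/\ {within `[0, +oo[, continuous mu},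
      forall r s, 0 <= r -> r <= s -> mu r <= mu s,
      mu 0 = 0
    & forall r, 0 < r -> 0 < mu r].

Section Viscosity.
(* The equation is F x v(x) (Dv(x)) (D^2 v(x)) = 0, where F is nonincreasing
   in its last argument for the Loewner order (degenerate ellipticity). *)
Variable F : 'cV[R]_n -> R -> 'cV[R]_n -> 'M[R]_n -> R.
Variables (A bd : set 'cV[R]_n) (b v : 'cV[R]_n -> R).

Definition viscosity_subsolution : Prop :=
  forall (x : 'cV[R]_n) (eta : 'cV[R]_n -> R) (U : set 'cV[R]_n),
    interior A x -> open U -> U x -> C2_on U eta ->
    (\forall y \near x, v y - eta y <= v x - eta x) ->
    F x (v x) (gradient eta x) (hessian eta x) <= 0.

Definition viscosity_supersolution : Prop :=
  forall (x : 'cV[R]_n) (eta : 'cV[R]_n -> R) (U : set 'cV[R]_n),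
    interior A x -> open U -> U x -> C2_on U eta ->
    (\forall y \near x, v x - eta x <= v y - eta y) ->
    0 <= F x (v x) (gradient eta x) (hessian eta x).

Definition viscosity_solution : Prop :=
  [/\ {within A, continuous v},
      viscosity_subsolution,
      viscosity_supersolution
    & forall x, bd x -> v x = b x].
End Viscosity.

Definition unique_nontrivial_viscosity_solution
    (F : 'cV[R]_n -> R -> 'cV[R]_n -> 'M[R]_n -> R)
    (A bd : set 'cV[R]_n) (b v : 'cV[R]_n -> R) : Prop :=
  let sol w := viscosity_solution F A bd b w /\ exists2 x, A x & w x != 0 in
  sol v /\ forall w, sol w -> forall x, A x -> w x = v x.

End Calculus.

(* State dimension n, k constraints g, m boundary polynomials h, p controls,
   r noise components.  psi is the polynomial that represents
   exp(- phi / lambda) on the boundary. *)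
Record control_data (R : realType) (n k m p r : nat) := ControlData {
  cd_g : k.-tuple (mpoly n R);
  cd_h : m.-tuple (mpoly n R);
  cd_f : 'cV[mpoly n R]_n;
  cd_G : 'M[mpoly n R]_(n, p);
  cd_B : 'M[mpoly n R]_(n, r);
  cd_Sigma_eps : 'M[R]_r;
  cd_R : 'M[R]_p;
  cd_lambda : R;
  cd_q : mpoly n R;
  cd_phi : mpoly n R;
  cd_psi : mpoly n R
}.

Section LinearlySolvableControl.
Variables (R : realType) (n k m p r : nat) (C : control_data R n k m p r).
Local Notation P := (mpoly n R).
Local Notation g := (cd_g C).
Local Notation h := (cd_h C).
Local Notation f := (cd_f C).
Local Notation G := (cd_G C).
Local Notation B := (cd_B C).
Local Notation Sigma_eps := (cd_Sigma_eps C).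
Local Notation lambda := (cd_lambda C).
Local Notation q := (cd_q C).
Local Notation phi := (cd_phi C).
Local Notation psi := (cd_psi C).

Definition Omega : set 'cV[R]_n := semialg g.
Definition dOmega : set 'cV[R]_n := zero_locus h.

(* The matrices Sigma = B Sigma_eps B^T and G R^-1 G^T, over R[x]. *)
Definition Sigma : 'M[P]_n := B *m constmx n Sigma_eps *m B^T.
Definition GRG : 'M[P]_n := G *m constmx n (invmx (cd_R C)) *m G^T.

Definition opL (Psi : P) : P :=
  (f^T *m pgrad Psi) 0 0 + 2^-1 *: \tr (phess Psi *m Sigma).

(* The operators of the linear equation and of the HJB equation, with the sign
   that makes them degenerate elliptic. *)
Definition linear_op (x : 'cV[R]_n) (s : R) (z : 'cV[R]_n) (X : 'M[R]_n) : R :=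
  lambda^-1 * peval q x * s
  - ((pevalmx f x)^T *m z) 0 0
  - 2^-1 * \tr (X *m pevalmx Sigma x).

Definition hjb_op (x : 'cV[R]_n) (s : R) (z : 'cV[R]_n) (X : 'M[R]_n) : R :=
  - peval q x
  - (z^T *m pevalmx f x) 0 0
  + 2^-1 * (z^T *m pevalmx GRG x *m z) 0 0
  - 2^-1 * \tr (X *m pevalmx Sigma x).

Definition psi_bd (x : 'cV[R]_n) : R := expR (- (peval phi x / lambda)).

Record standing_assumptions : Prop := StandingAssumptions {
  sa_compact : compact Omega;
  sa_origin : Omega 0;
  (* The origin counts as a boundary point, even when it is not one
     topologically; it may or may not be cut out by the h_i. *)
  sa_boundary : dOmega = topo_boundary Omega
             \/ dOmega = topo_boundary Omega `|` [set 0];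
  sa_f0 : pevalmx f 0 = 0;
  sa_G0 : pevalmx G 0 = 0;
  sa_B0 : pevalmx B 0 = 0;
  sa_Sigma_eps : psd_mx Sigma_eps;
  sa_R : pd_mx (cd_R C);
  sa_q_ge0 : forall x, 0 <= peval q x;
  sa_phi_ge0 : forall x, 0 <= peval phi x;
  sa_q_pd : pd_fun_on Omega (peval q);
  sa_phi_pd : pd_fun_on Omega (peval phi);
  sa_phi_boundary : forall x, dOmega x -> x != 0 -> 0 < peval phi x;
  sa_lambda : 0 < lambda;
  sa_noise : forall x, lambda *: pevalmx GRG x = pevalmx Sigma x;
  sa_psi : forall x, dOmega x -> peval psi x = psi_bd x;
  sa_viscosity : exists Psi_star V_star : 'cV[R]_n -> R,
    [/\ unique_nontrivial_viscosity_solution linear_op Omega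
          (dOmega `|` [set 0]) psi_bd Psi_star,
        unique_nontrivial_viscosity_solution hjb_op Omega
          (dOmega `|` [set 0]) (peval phi) V_star
      & forall x, Omega x ->
          0 < Psi_star x /\ V_star x = - lambda * ln (Psi_star x)]
}.

(* The decision variables.  The multipliers of the last two families are
   indexed by {0,1}^(k+1) because Omega is intersected with a half-space. *)
Record sos_variables := SosVariables {
  Psi_l : P;
  Psi_u : P;
  S1 : {ffun 'I_k -> bool} -> P;
  S2 : {ffun 'I_k -> bool} -> P;
  S3 : {ffun 'I_k -> bool} -> P;
  S4 : {ffun 'I_k.+1 -> bool} -> P;
  S5 : {ffun 'I_k.+1 -> bool} -> P;
  T1 : 'I_m -> P;
  T2 : 'I_m -> P;
  T3 : 'I_m -> P;
  epsilon : R
}.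

Record sos_feasible (d : nat) (s : sos_variables) : Prop := SosFeasible {
  sf_deg_Psi_l : deg_le d (Psi_l s);
  sf_deg_Psi_u : deg_le d (Psi_u s);
  sf_S1 : forall nu, sos (S1 s nu) /\ deg_le d (S1 s nu);
  sf_S2 : forall nu, sos (S2 s nu) /\ deg_le d (S2 s nu);
  sf_S3 : forall nu, sos (S3 s nu) /\ deg_le d (S3 s nu);
  sf_S4 : forall nu, sos (S4 s nu) /\ deg_le d (S4 s nu);
  sf_S5 : forall nu, sos (S5 s nu) /\ deg_le d (S5 s nu);
  sf_T1 : forall i, deg_le d (T1 s i);
  sf_T2 : forall i, deg_le d (T2 s i);
  sf_T3 : forall i, deg_le d (T3 s i);
  sf_lower : sos (- (lambda^-1 *: (q * Psi_l s)) + opL (Psi_l s)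
                  - opD g (S1 s));
  sf_upper : sos (lambda^-1 *: (q * Psi_u s) - opL (Psi_u s) - opD g (S2 s));
  sf_gap : sos (mpolyC n (epsilon s) - (Psi_u s - Psi_l s) - opD g (S3 s));
  sf_bd_ge0 : opB_sos h (Psi_l s) (T1 s);
  sf_bd_lower : opB_sos h (psi - Psi_l s) (T2 s);
  sf_bd_upper : opB_sos h (Psi_u s - psi) (T3 s);
  sf_mono_pos : forall i : 'I_n,
    sos (- mderiv i (Psi_l s) - opD [tuple of rcons g (xvar R i)] (S4 s));
  sf_mono_neg : forall i : 'I_n,
    sos (mderiv i (Psi_l s) - opD [tuple of rcons g (- xvar R i)] (S5 s));
  sf_origin : peval (Psi_l s) 0 = 1
}.

Definition sos_solution (d : nat) (s : sos_variables) : Prop :=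
  sos_feasible d s /\
  forall s', sos_feasible d s' -> epsilon s <= epsilon s'.

Definition generator (u : 'cV[R]_n -> R -> 'cV[R]_p)
    (V : 'cV[R]_n -> R -> R) (x : 'cV[R]_n) (t : R) : R :=
  time_derivative V x t
  + ((gradient (V^~ t) x)^T *m (pevalmx f x + pevalmx G x *m u x t)) 0 0
  + 2^-1 * \tr (hessian (V^~ t) x *m pevalmx Sigma x).

Definition is_SCLF (V : 'cV[R]_n -> R -> R) : Prop :=
  [/\ C21_on Omega V,
      forall t, 0 < t -> pd_fun_on Omega (V^~ t),
      exists2 mu, class_K mu &
        forall x t, Omega x -> 0 < t -> mu (eucl_norm x) <= V x t
    & exists u : 'cV[R]_n -> R -> 'cV[R]_p,
        forall x t, Omega x -> 0 < t -> x != 0 -> generator u V x t <= 0].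

Definition V_u (s : sos_variables) (x : 'cV[R]_n) : R :=
  - lambda * ln (peval (Psi_l s) x).

End LinearlySolvableControl.

(* Main.v *)
Require Import Defs.
From HB Require Import structures.
From mathcomp Require Import all_boot all_order all_algebra.
From mathcomp Require Import all_classical all_reals all_analysis.
From mathcomp Require Import -(notations) mpoly.
From mathcomp Require Import ring lra.

Set Implicit Arguments.
Unset Strict Implicit.
Unset Printing Implicit Defensive.

Import Order.TTheory GRing.Theory Num.Theory.
Import numFieldNormedType.Exports.

Local Open Scope classical_set_scope.
Local Open Scope ring_scope.

(** Why [V_u = - lambda ln Psi_l] is a stochastic control Lyapunov function.

    Smoothness is clear: [Psi_l] is a polynomial that is positive on the domain,
    hence on an open neighbourhood of it, where its logarithm is smooth
    ([C21_on_ln_peval]).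

    Positive definiteness amounts to [Psi_l < 1] off the origin, where
    [Psi_l = 1], and is a maximum principle ([subsolution_lt1]).  Take a maximum
    point of [Psi_l] other than 0 on the compact domain.  If it is interior, the
    gradient vanishes there and the Hessian is negative semidefinite, so
    [L Psi_l <= 0] because [Sigma] is positive semidefinite
    ([mxtrace_mul_psd_ge0]); but the first certificate of the program gives
    [L Psi_l >= q Psi_l / lambda > 0].  If it is on the boundary, the boundary
    certificate gives [Psi_l <= exp (- phi / lambda) < 1].  So the maximum over
    the domain is the value 1 at the origin, and is attained nowhere else.

    On a compact set a continuous positive definite function always dominates a
    class K function of the norm, obtained by an inf-convolution
    ([class_K_minorant]).

    The generator is made nonpositive by the feedback
    [u = - 1/2 R^-1 G^T grad V].  Since [lambda G R^-1 G^T = Sigma], the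
    quadratic gradient term that it produces cancels exactly the one that the
    logarithm adds to the second order part, and what remains is
    [L V = - (lambda / Psi) L Psi] ([generator_log_transform]), which the first
    certificate makes nonpositive.  This is the cancellation that turns the HJB
    equation into a linear one. *)

(** * Traces of products of positive semidefinite matrices *)

Section Mat.
Variable (R : realType).

Lemma tr_mx11 (M : 'M[R]_1) : M^T 0 0 = M 0 0.
Proof. by rewrite mxE. Qed.

(** The form is nonnegative along the line [u + t v].  When [v^T S v > 0] the
    claim is its nonnegativity at the minimizing [t]; when [v^T S v = 0] it is
    affine in [t], so its slope [2 u^T S v] vanishes. *)
Lemma psd_mx_cauchy_schwarz n (S : 'M[R]_n) (u v : 'cV[R]_n) : psd_mx S ->
  (u^T *m S *m v) 0 0 ^+ 2 <= (u^T *m S *m u) 0 0 * (v^T *m S *m v) 0 0.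
Proof.
move=> [Ssym Spos].
set a := (u^T *m S *m u) 0 0; set b := (u^T *m S *m v) 0 0.
set c := (v^T *m S *m v) 0 0.
have vu : (v^T *m S *m u) 0 0 = b.
  by rewrite -tr_mx11 !trmx_mul trmxK Ssym mulmxA.
have quad s t : 0 <= s ^+ 2 * a + 2 * s * t * b + t ^+ 2 * c.
  have := Spos (s *: u + t *: v).
  have -> : (s *: u + t *: v)^T = s *: u^T + t *: v^T.
    by apply/matrixP => i j; rewrite !mxE.
  rewrite !mulmxDl !mulmxDr -!scalemxAl -!scalemxAr.
  have -> (A B C D : 'M[R]_1) : (s *: (s *: A) + s *: (t *: B)
      + (t *: (s *: C) + t *: (t *: D))) 0 0
      = s * (s * A 0 0) + s * (t * B 0 0) + (t * (s * C 0 0) + t * (t * D 0 0)).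
    by rewrite !mxE.
  rewrite vu -/a -/b -/c => /le_trans; apply.
  by rewrite le_eqVlt; apply/orP; left; apply/eqP; ring.
have [c0|c_neq0] := eqVneq c 0.
  have [->|b0] := eqVneq b 0; first by rewrite c0 expr0n/= mulr0.
  (* This [t] gives the affine form the value [-1]. *)
  have := quad 1 (- ((a + 1) / (2 * b))); rewrite c0 mulr0 addr0.
  have -> : 1 ^+ 2 * a + 2 * 1 * - ((a + 1) / (2 * b)) * b = -1 by field.
  by rewrite lerNr oppr0 ler10.
have c_gt0 : 0 < c by rewrite lt_neqAle eq_sym c_neq0 Spos.
(* The minimizing point [u - (b / c) v], scaled by [c]. *)
have := quad c (- b).
have -> : c ^+ 2 * a + 2 * c * - b * b + (- b) ^+ 2 * c = c * (a * c - b ^+ 2).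
  by ring.
by rewrite pmulr_rge0// subr_ge0.
Qed.

Lemma quad_delta_mx n (S : 'M[R]_n) i j :
  ((delta_mx i 0 : 'cV[R]_n)^T *m S *m (delta_mx j 0 : 'cV[R]_n)) 0 0 = S i j.
Proof. by rewrite trmx_delta -rowE -colE !mxE. Qed.

(** One step of the Cholesky decomposition: Cauchy-Schwarz with the basis
    vector [e_i] says that subtracting this rank one matrix keeps the form
    nonnegative. *)
Lemma psd_mx_elim_pivot n (S : 'M[R]_n) i : psd_mx S -> S i i != 0 ->
  psd_mx (S - (S i i)^-1 *: (col i S *m (col i S)^T)).
Proof.
move=> Spsd Sii; have [Ssym Spos] := Spsd; split.
  by rewrite linearB linearZ /= trmx_mul trmxK Ssym.
move=> v; rewrite mulmxBr mulmxBl -scalemxAr -scalemxAl mxE [X in _ + X]mxE.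
rewrite [X in _ - X]mxE subr_ge0 !mulmxA -(mulmxA _ _ v) mxE big_ord1.
have Sii_gt0 : 0 < S i i.
  by rewrite lt_neqAle eq_sym Sii -(quad_delta_mx S i i) Spos.
have -> : ((col i S)^T *m v) 0 0 = (v^T *m col i S) 0 0.
  by rewrite -tr_mx11 trmx_mul trmxK.
rewrite -expr2 colE mulmxA ler_pdivrMl// mulrC.
rewrite -[X in _ <= _ * X](quad_delta_mx S i i).
exact: psd_mx_cauchy_schwarz.
Qed.

(** [S] is peeled off one rank one matrix [c c^T] at a time, and
    [\tr (H c c^T) = c^T H c >= 0].  A step clears the pivot and creates no
    nonzero diagonal entry, so the number of those decreases; when none is left
    Cauchy-Schwarz forces [S = 0]. *)
Lemma mxtrace_mul_psd_ge0 n (H S : 'M[R]_n) :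
  (forall v : 'cV[R]_n, 0 <= (v^T *m H *m v) 0 0) -> psd_mx S ->
  0 <= \tr (H *m S).
Proof.
move=> Hpos.
have [N] := ubnP #|[pred i | S i i != 0]|.
elim: N S => // N IH S ltN Spsd.
have [i Sii|S0] := pickP (fun i => S i i != 0); last first.
  suff -> : S = 0 by rewrite mulmx0 mxtrace0.
  apply/matrixP => i j; rewrite mxE; apply/eqP.
  rewrite -sqrf_eq0 eq_le sqr_ge0 andbT -quad_delta_mx.
  apply: le_trans (psd_mx_cauchy_schwarz _ _ Spsd) _.
  by rewrite !quad_delta_mx (eqP (negbFE (S0 i))) mul0r.
set S' := S - (S i i)^-1 *: (col i S *m (col i S)^T).
have S'psd : psd_mx S' by exact: psd_mx_elim_pivot.
have Sii_gt0 : 0 < S i i.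
  by rewrite lt_neqAle eq_sym Sii -(quad_delta_mx S i i); case: Spsd => _ ->.
have S'E j : S' j j = S j j - (S i i)^-1 * S j i ^+ 2.
  by rewrite !mxE big_ord1 !mxE.
have -> : S = S' + (S i i)^-1 *: (col i S *m (col i S)^T) by rewrite subrK.
rewrite mulmxDr mxtraceD addr_ge0//; last first.
  rewrite -scalemxAr mxtraceZ mulmxA mxtrace_mulC mulmxA /mxtrace big_ord1.
  by apply: mulr_ge0 => //; rewrite invr_ge0 ltW.
apply: IH => //; rewrite -ltnS; apply: leq_trans ltN; rewrite ltnS.
apply: proper_card; apply/properP; split.
  apply/fintype.subsetP => j; rewrite !inE; apply: contraNneq => Sjj0.
  rewrite eq_le -[in X in _ && X]quad_delta_mx; case: (S'psd) => _ ->.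
  by rewrite andbT S'E Sjj0 sub0r oppr_le0 mulr_ge0 ?sqr_ge0// invr_ge0 ltW.
by exists i; rewrite inE/= ?Sii // S'E expr2 mulKf ?subrr ?eqxx.
Qed.
End Mat.

(** * Polynomial functions and their derivatives *)

Section Poly.
Variables (R : realType) (n : nat).
Local Notation P := (mpoly n R).
Implicit Types (p q : P) (x v : 'cV[R]_n).

(** Polynomials are generated as a ring by constants and variables; this reduces
    the calculus of polynomial functions to the sum and product rules. *)
Lemma mpoly_ring_ind (Q : P -> Prop) :
  (forall c, Q (mpolyC n c)) -> (forall i, Q (xvar R i)) ->
  (forall p q, Q p -> Q q -> Q (p + q)) ->
  (forall p q, Q p -> Q q -> Q (p * q)) -> forall p, Q p.
Proof.
move=> QC QX QD QM; elim/mpolyind => [|c mn p _ _ Qp].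
  by rewrite -[0](mpolyC0 n R); exact: QC.
apply: (QD) => //; rewrite -mul_mpolyC; apply: (QM) => //.
rewrite mpolyXE_id; elim/big_ind: _ => //.
- by rewrite -[1](mpolyC1 n R); exact: QC.
move=> i _; elim: (mn i) => [|e IH].
  by rewrite expr0 -[1](mpolyC1 n R); exact: QC.
rewrite exprS; apply: (QM (mpolyX _ _) (mpolyX _ _ ^+ e)); last exact: IH.
exact: QX.
Qed.

Lemma pevalD p q x : peval (p + q) x = peval p x + peval q x.
Proof. exact: mevalD. Qed.
Lemma pevalM p q x : peval (p * q) x = peval p x * peval q x.
Proof. exact: mevalM. Qed.
Lemma pevalN p x : peval (- p) x = - peval p x.
Proof. exact: mevalN. Qed.
Lemma pevalB p q x : peval (p - q) x = peval p x - peval q x.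
Proof. exact: mevalB. Qed.
Lemma pevalZ c p x : peval (c *: p) x = c * peval p x.
Proof. exact: mevalZ. Qed.

Lemma peval_continuous p : continuous (peval p).
Proof.
elim/mpoly_ring_ind: p => [c|i|p q cp cq|p q cp cq] x.
- rewrite (_ : peval _ = cst c); first by move=> ?; exact: cst_continuous.
  by apply/funext => y; exact: mevalC.
- rewrite (_ : peval _ = fun y => y i 0); first exact: coord_continuous.
  by apply/funext => y; exact: mevalXU.
- rewrite (_ : peval _ = peval p + peval q).
    exact: (continuousD (cp x) (cq x)).
  by apply/funext => y; exact: mevalD.
- rewrite (_ : peval _ = peval p \* peval q).
    exact: (continuousM (cp x) (cq x)).
  by apply/funext => y; exact: mevalM.
Qed.

Lemma is_derive_coord i x v : is_derive x v (fun y : 'cV[R]_n => y i 0) (v i 0).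
Proof.
have dd : derivable (fun y : 'cV[R]_n => y i 0) x v.
  by apply: diff_derivable; exact: differentiable_coord.
apply: DeriveDef => //; apply: lim_near_cst => //=; near=> h.
rewrite !mxE addrK /GRing.scale/= mulKf//.
by near: h; exact: nbhs_dnbhs_neq.
Unshelve. all: by end_near. Qed.

(** The derivative in the direction [v], as a polynomial again, so that it can
    be iterated. *)
Definition pderiv v p : P := \sum_i v i 0 *: mderiv i p.

Lemma is_derive_peval p x v : is_derive x v (peval p) (peval (pderiv v p) x).
Proof.
elim/mpoly_ring_ind: p => [c|i|p q cp cq|p q cp cq].
- rewrite (_ : peval _ = cst c); last by apply/funext => y; exact: mevalC.
  apply: is_derive_eq; rewrite /pderiv big1 ?[peval 0 x]meval0 // => j _.
  by rewrite mderivC scaler0.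
- rewrite (_ : peval _ = fun y => y i 0); last first.
    by apply/funext => y; exact: mevalXU.
  apply: (is_derive_eq (is_derive_coord i x v)).
  rewrite /pderiv (bigD1 i)//= big1 ?addr0 => [|j ji].
    have -> : mderiv i (mpolyX R (mnm1 i)) = 1.
      rewrite mderivX mnm1E eqxx scale1r -(mpolyX0 n R); congr (mpolyX R _).
      by apply/mnmP => j; rewrite mnmBE mnm0E subnn.
    rewrite pevalZ.
    by rewrite /peval meval1 mulr1.
  by rewrite mderivX mnm1E eq_sym (negbTE ji) scale0r scaler0.
- rewrite (_ : peval _ = peval p + peval q); last first.
    by apply/funext => y; exact: mevalD.
  apply: is_derive_eq; rewrite -pevalD; congr (peval _ x).
  rewrite /pderiv -big_split; apply: eq_bigr => i _.
  by rewrite mderivD scalerDr.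
- rewrite (_ : peval _ = peval p * peval q); last first.
    by apply/funext => y; exact: mevalM.
  apply: is_derive_eq; rewrite /GRing.scale/= -!pevalM -pevalD.
  congr (peval _ x).
  rewrite /pderiv !mulr_sumr -big_split; apply: eq_bigr => i _/=.
  by rewrite mderivM scalerDr addrC -!scalerAr mulrC.
Qed.

End Poly.

(** * Second order conditions at an interior maximum *)

(** With [f''(c) > 0] the derivative would be positive just to the right of
    [c], and the mean value theorem would make [f] exceed [f c] there. *)
Lemma second_derivative_test (R : realType) (f df : R -> R) (c d2f : R) :
  (forall s : R, is_derive s 1 f (df s)) -> is_derive c 1 df d2f ->
  (\forall s \near c, f s <= f c) -> df c = 0 /\ d2f <= 0.
Proof.
move=> dfE ddf /nbhs_ballP[e/= e_gt0 fmax].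
have derf (s : R) : derivable f s 1 by case: (dfE s).
have df0 : df c = 0.
  have near_max t : t \in `]c - e, c + e[%R -> f t <= f c.
    rewrite in_itv/= => /andP[ct te]; apply: fmax; rewrite /ball/= ltr_norml.
    by apply/andP; split; lra.
  have /@derive_val <- : is_derive c 1 f 0.
    apply: (derive1_at_max _ _ _ near_max) => [||]; [lra|by []|].
    by rewrite in_itv/=; apply/andP; split; lra.
  by have /@derive_val -> := dfE c.
split=> //; rewrite leNgt; apply/negP => d2f_gt0.
have slope : h^-1 *: (df (h *: (1 : R) + c) - df c) @[h --> 0^'] --> d2f.
  by case: ddf => ddf <-; exact: ddf.
have : nbhs 0 (fun h : R =>
    h != 0 -> 0 < h^-1 *: (df (h *: (1 : R) + c) - df c)).
  exact: (cvgr_gt _ slope _ d2f_gt0).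
move=> /nbhs_ballP[e'/= e'_gt0 slope_gt0].
have df_gt0 h : 0 < h -> h < e' -> 0 < df (c + h).
  move=> h_gt0 he'; have := slope_gt0 h.
  rewrite /ball/= sub0r normrN gtr0_norm// => /(_ he' (lt0r_neq0 h_gt0)).
  rewrite df0 subr0 /GRing.scale/= mulr1 addrC.
  by rewrite pmulr_rgt0// invr_gt0.
pose b := Num.min e e' / 2.
have b_gt0 : 0 < b by rewrite divr_gt0// lt_min e_gt0.
have [be be'] : b < e /\ b < e'.
  have m_gt0 : 0 < Num.min e e' by rewrite lt_min e_gt0.
  have : Num.min e e' <= e /\ Num.min e e' <= e' by rewrite !ge_min !lexx orbT.
  by rewrite /b => -[? ?]; split; lra.
have [||z] := @MVT R f df c (c + b) _ (fun s _ => dfE s).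
- by rewrite ltrDl.
- apply: continuous_subspaceT => s.
  exact/differentiable_continuous/derivable1_diffP.
- rewrite in_itv/= => /andP[cz zb] fE.
  have : f (c + b) <= f c.
    by apply: fmax; rewrite /ball/= opprD addNKr normrN gtr0_norm.
  have : 0 < df (c + (z - c)) by apply: df_gt0; lra.
  rewrite (addrC c) subrK => dfz; apply/negP; rewrite -ltNge -subr_gt0 fE.
  by rewrite addrAC subrr add0r mulr_gt0.
Qed.

(** Directional derivatives are ordinary derivatives along lines, which gives
    access to the one variable chain rule and second derivative test. *)
Lemma is_derive_lineP (R : realType) (V : normedModType R) (f : V -> R)
    (x v : V) (s : R) (d : R) :
  is_derive (s *: v + x) v f d <-> is_derive s 1 (fun h => f (h *: v + x)) d.
Proof.
have E : (fun h : R =>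
      h^-1 *: ((f \o shift (s *: v + x)) (h *: v) - f (s *: v + x)))
  = (fun h : R => h^-1 *: (((fun h => f (h *: v + x)) \o shift s) (h *: (1 : R))
       - f (s *: v + x))).
  apply/funext => h /=.
  by rewrite addrA -scalerDl [h *: 1]mulr1.
by split=> -[dd de]; split; move: dd de; rewrite /derivable /derive E.
Qed.

Section Poly2.
Variables (R : realType) (n : nat).
Local Notation P := (mpoly n R).
Implicit Types (p q : P) (x v : 'cV[R]_n).

Lemma is_derive_peval_line p x v (s : R) :
  is_derive s 1 (fun h => peval p (h *: v + x))
    (peval (pderiv v p) (s *: v + x)).
Proof.
exact: (is_derive_lineP (peval p) x v s _).1 (is_derive_peval p _ v).
Qed.

Lemma peval_sum (I : Type) (r : seq I) (Q : pred I) (F : I -> P) x :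
  peval (\sum_(i <- r | Q i) F i) x = \sum_(i <- r | Q i) peval (F i) x.
Proof. exact: raddf_sum. Qed.

Lemma peval_pderiv p x v :
  peval (pderiv v p) x = (v^T *m pevalmx (pgrad p) x) 0 0.
Proof.
rewrite peval_sum mxE; apply: eq_bigr => i _.
by rewrite pevalZ !mxE.
Qed.

Lemma peval_pderiv2 p x v :
  peval (pderiv v (pderiv v p)) x = (v^T *m pevalmx (phess p) x *m v) 0 0.
Proof.
rewrite peval_sum -mulmxA mxE; apply: eq_bigr => i _.
rewrite pevalZ [in RHS]mxE; congr (_ * _); rewrite mxE.
rewrite /pderiv raddf_sum peval_sum; apply: eq_bigr => j _.
by rewrite /= mderivZ pevalZ !mxE mulrC.
Qed.

Lemma peval_local_max p (A : set 'cV[R]_n) x : interior A x ->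
  (forall y, A y -> peval p y <= peval p x) ->
  pevalmx (pgrad p) x = 0 /\
  forall v, (v^T *m pevalmx (phess p) x *m v) 0 0 <= 0.
Proof.
move=> xA xmax.
have test v : peval (pderiv v p) x = 0 /\ peval (pderiv v (pderiv v p)) x <= 0.
  have line0 : 0 *: v + x = x by rewrite scale0r add0r.
  have := @second_derivative_test R (fun h => peval p (h *: v + x))
    (fun h => peval (pderiv v p) (h *: v + x)) 0 _
    (is_derive_peval_line p x v) (is_derive_peval_line (pderiv v p) x v 0).
  rewrite !line0; apply.
  have line_cvg : (h *: v + x) @[h --> (0 : R)] --> x.
    rewrite -[X in _ --> X]line0.
    by apply: cvgD; [exact: scalel_continuous | exact: cvg_cst].
  have nearA : \forall h \near (0 : R), A (h *: v + x) := line_cvg _ xA.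
  by apply: filterS nearA => h; exact: xmax.
split; last by move=> v; rewrite -peval_pderiv2; case: (test v).
apply/matrixP => i j; rewrite [j]ord1 [RHS]mxE.
have [<- _] := test (delta_mx i 0).
by rewrite peval_pderiv trmx_delta -rowE [RHS]mxE.
Qed.

End Poly2.

(** * The logarithm of a positive polynomial *)

Lemma near_eq_continuous (S T : topologicalType) (f g : S -> T) (x : S) :
  (\forall y \near x, f y = g y) -> {for x, continuous f} ->
  {for x, continuous g}.
Proof.
move=> fg cf; rewrite /prop_for /continuous_at -(nbhs_singleton fg).
exact: (cvg_trans (near_eq_cvg fg) cf).
Qed.

Section LogPoly.
Variables (R : realType) (n : nat) (p : mpoly n R) (c : R).
Local Notation P := (mpoly n R).
Implicit Types (q : P) (x v : 'cV[R]_n).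

Let W x := c * ln (peval p x).
Let U : set 'cV[R]_n := [set x | 0 < peval p x].

Lemma open_peval_gt0 : open U.
Proof.
rewrite (_ : U = peval p @^-1` [set y | 0 < y])//.
apply: open_comp; last exact: open_gt.
by move=> x _; exact: peval_continuous.
Qed.

Lemma pderiv_delta_mx q i : pderiv (delta_mx i 0) q = mderiv i q.
Proof.
rewrite /pderiv (bigD1 i)//= big1 ?addr0 => [|j /negbTE ji].
  by rewrite mxE !eqxx scale1r.
by rewrite mxE ji scale0r.
Qed.

Lemma is_derive_ln_peval x v : U x ->
  is_derive x v W (c * (peval (pderiv v p) x / peval p x)).
Proof.
move=> Ux; have x0 : 0 *: v + x = x by rewrite scale0r add0r.
rewrite -[X in is_derive X](x0).
apply: (is_derive_lineP W x v 0 _).2.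
have dp := is_derive_peval_line p x v 0; rewrite x0 in dp.
have dl : is_derive (peval p (0 *: v + x)) 1 (@ln R) (peval p x)^-1.
  by rewrite x0; exact: is_derive1_ln.
have dc := is_derive1_comp dl dp.
rewrite (_ : (fun h => _) = c *: (@ln R \o (fun h => peval p (h *: v + x)))) //.
by apply: is_derive_eq; rewrite /GRing.scale/= [_ / _]mulrC.
Qed.

Lemma partial_ln_peval x i : U x ->
  partial i W x = c * (peval (mderiv i p) x / peval p x).
Proof.
move=> Ux; have /@derive_val := is_derive_ln_peval (delta_mx i 0) Ux.
by rewrite pderiv_delta_mx.
Qed.

(** The first order formula holds on a whole neighbourhood, so it may be
    differentiated once more. *)
Lemma near_partial_ln_peval x i : U x ->
  \forall y \near x, c * (peval (mderiv i p) y / peval p y) = partial i W y.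
Proof.
move=> Ux; have := open_nbhs_nbhs (conj open_peval_gt0 Ux).
by apply: filterS => y Uy; rewrite partial_ln_peval.
Qed.

Lemma is_derive_partial_ln_peval x i j : U x ->
  is_derive x (delta_mx i 0) (partial j W)
    (c * (peval (mderiv i (mderiv j p)) x / peval p x
          - peval (mderiv i p) x * peval (mderiv j p) x / peval p x ^+ 2)).
Proof.
move=> Ux; apply: near_eq_is_derive (near_partial_ln_peval j Ux) _.
have px0 : peval p x != 0 by rewrite gt_eqF.
have dj := is_derive_peval (mderiv j p) x (delta_mx i 0).
have dp := is_derive_peval p x (delta_mx i 0).
rewrite !pderiv_delta_mx in dj dp.
have [dp1 dp2] := dp.
have dV := DeriveDef (derivableV px0 dp1) (deriveV px0 dp1).
rewrite dp2 in dV.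
rewrite (_ : (fun y => _)
  = c *: (peval (mderiv j p) * (fun y => (peval p y)^-1)))//.
by apply: is_derive_eq; rewrite /GRing.scale/=; field.
Qed.

Lemma partial_partial_ln_peval x i j : U x ->
  partial i (partial j W) x =
    c * (peval (mderiv i (mderiv j p)) x / peval p x
         - peval (mderiv i p) x * peval (mderiv j p) x / peval p x ^+ 2).
Proof.
by move=> Ux; have /@derive_val := is_derive_partial_ln_peval i j Ux.
Qed.

Lemma C21_on_ln_peval : C21_on U (fun x _ => W x).
Proof.
exists U; first by split; [exact: open_peval_gt0|].
move=> x t Ux _.
have px0 : peval p x != 0 by rewrite gt_eqF.
have cont_fst (F : 'cV[R]_n -> R) : {for x, continuous F} ->
    {for (x, t), continuous (fun z : 'cV[R]_n * R => F z.1)}.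
  by move=> cF; exact: (cvg_comp fst F cvg_fst cF).
have cst_cont (T : topologicalType) (k : R) (y : T) :
    {for y, continuous (fun=> k)}.
  exact: cst_continuous.
have cinv : {for x, continuous (fun y => (peval p y)^-1)}.
  by apply: continuousV => //; exact: peval_continuous.
split.
- apply: cont_fst; apply: continuousM => //.
  by apply: continuous_comp; [exact: peval_continuous|exact: continuous_ln].
- split; first exact: derivable_cst.
  have -> : (fun z : 'cV[R]_n * R => time_derivative (fun y _ => W y) z.1 z.2)
      = fun=> 0.
    by apply/funext => z; exact: derive1_cst.
  exact: cst_cont.
- move=> i; split; first by case: (is_derive_ln_peval (delta_mx i 0) Ux).
  apply: (cont_fst (partial i W)).
  apply: near_eq_continuous (near_partial_ln_peval i Ux) _.
  apply: continuousM => //; apply: continuousM => //; exact: peval_continuous.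
- move=> i j; split; first by case: (is_derive_partial_ln_peval i j Ux).
  apply: (cont_fst (partial i (partial j W))).
  have near2 : \forall y \near x,
      c * (peval (mderiv i (mderiv j p)) y / peval p y
        - peval (mderiv i p) y * peval (mderiv j p) y / peval p y ^+ 2)
      = partial i (partial j W) y.
    have := open_nbhs_nbhs (conj open_peval_gt0 Ux).
    by apply: filterS => y Uy; rewrite partial_partial_ln_peval.
  apply: near_eq_continuous near2 _.
  apply: continuousM => //; apply: continuousB.
    by apply: continuousM => //; exact: peval_continuous.
  apply: continuousM; first by apply: continuousM; exact: peval_continuous.
  apply: continuousV; first by rewrite expf_neq0.
  by apply: continuousM; exact: peval_continuous.
Qed.
End LogPoly.

(** * Class K minorants on compact sets *)

Lemma eucl_norm_continuous (R : realType) (n : nat) :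
  continuous (@eucl_norm R n).
Proof.
have -> : @eucl_norm R n = Num.sqrt \o peval (\sum_i xvar R i ^+ 2).
  apply/funext => x; rewrite /eucl_norm /= peval_sum; congr Num.sqrt.
  by apply: eq_bigr => i _; rewrite [in RHS]expr2 pevalM [peval _ x]mevalXU.
move=> x; apply: continuous_comp; first exact: peval_continuous.
exact: sqrt_continuous.
Qed.

Lemma eucl_norm0 (R : realType) (n : nat) : @eucl_norm R n 0 = 0.
Proof.
by rewrite /eucl_norm big1 ?sqrtr0// => i _; rewrite mxE expr0n.
Qed.

(** The minorant is [mu r = min_(x in A) (V x + max (0, r - |x|))].  The penalty
    makes it 1-Lipschitz in [r], whereas the more obvious minimum of [V] over
    [|x| >= r] need not be continuous; taking [x] itself as competitor gives
    [mu |x| <= V x].  The minimum is attained, and the minimized sum vanishes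
    only at [x = 0] with [r <= 0], so [mu r > 0] for [r > 0]. *)
Lemma class_K_minorant (R : realType) (n : nat) (A : set 'cV[R]_n)
    (V : 'cV[R]_n -> R) :
  compact A -> A 0 -> {within A, continuous V} -> pd_fun_on A V ->
  exists2 mu, class_K mu & forall x, A x -> mu (eucl_norm x) <= V x.
Proof.
move=> cA A0 cV [V0 Vpos].
pose F r x := V x + Num.max 0 (r - eucl_norm x).
have minF r : exists x, A x /\ forall y, A y -> F r x <= F r y.
  have cF : {within A, continuous (F r)}.
    have cmax : continuous (fun x : 'cV[R]_n => Num.max 0 (r - eucl_norm x)).
      move=> x; have cr : {for x, continuous (fun y => r - eucl_norm y)}.
        apply: continuousB; first exact: cst_continuous.
        exact: eucl_norm_continuous.
      by have := @continuous_max _ _ (cst 0) _ x (@cst_continuous _ _ _ x) cr.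
    move=> x.
    apply: (@continuousD _ _ (subspace A) V _ x (cV x)).
    by move: (x); exact: (continuous_subspaceT cmax).
  have [|x xA xmin] := compact_EVT_min _ cA cF; first by exists 0.
  by exists x; rewrite inE in xA; split=> // y Ay; apply: xmin; rewrite inE.
have [z zP] := choice minF.
pose mu r := F r (z r).
have mu_le r y : A y -> mu r <= F r y by case: (zP r) => _; apply.
have Az r : A (z r) by case: (zP r).
have V_ge0 x : A x -> 0 <= V x.
  by move=> Ax; have [->|x0] := eqVneq x 0; [rewrite V0|exact/ltW/Vpos].
have lip r s : r <= s -> mu r <= mu s <= mu r + (s - r).
  move=> rs; apply/andP; split.
    apply: le_trans (mu_le _ _ (Az s)) _; rewrite lerD2l.
    by rewrite ge_max !le_max lexx/= lerB// orbT.
  apply: le_trans (mu_le _ _ (Az r)) _; rewrite -addrA lerD2l ge_max.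
  rewrite addr_ge0 ?le_max ?lexx ?subr_ge0//=.
  rewrite -lerBlDr le_max; apply/orP; right; lra.
exists mu.
- split.
  + apply: continuous_subspaceT => r; apply/cvgrPdist_le => e e0.
    near=> s.
    have : `|r - s| <= e by near: s; exact: cvgr_dist_le.
    apply: le_trans; have [rs|/ltW sr] := leP r s.
    * have /andP[? ?] := lip _ _ rs; rewrite !ler0_norm; lra.
    * have /andP[? ?] := lip _ _ sr; rewrite !ger0_norm; lra.
  + by move=> r s _ /lip /andP[].
  + apply/eqP; rewrite eq_le; apply/andP; split.
      by rewrite (le_trans (mu_le _ _ A0))// /F V0 eucl_norm0 subrr maxxx addr0.
    by rewrite addr_ge0 ?V_ge0// le_max lexx.
  + move=> r r0; rewrite /mu /F; have [->|zr0] := eqVneq (z r) 0.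
      by rewrite V0 eucl_norm0 subr0 add0r lt_max r0 orbT.
    by rewrite ltr_pwDl ?Vpos// le_max lexx.
- move=> x Ax; apply: le_trans (mu_le _ _ Ax) _.
  by rewrite /F subrr maxxx addr0.
Unshelve. all: by end_near. Qed.

(** * Evaluating polynomial matrices and certificates *)

Section Evaluation.
Variables (R : realType) (n : nat).
Local Notation P := (mpoly n R).
Implicit Types (p q : P) (x : 'cV[R]_n).

Lemma pevalmxM a b c (A : 'M[P]_(a, b)) (B : 'M[P]_(b, c)) x :
  pevalmx (A *m B) x = pevalmx A x *m pevalmx B x.
Proof. exact: (map_mxM (meval (fun i => x i 0))). Qed.

Lemma pevalmx_constmx a b (M : 'M[R]_(a, b)) x : pevalmx (constmx n M) x = M.
Proof. by apply/matrixP => i j; rewrite !mxE [LHS]mevalC. Qed.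

Lemma pevalmx_congruence a b (A : 'M[P]_(a, b)) (M : 'M[R]_b) x :
  pevalmx (A *m constmx n M *m A^T) x = pevalmx A x *m M *m (pevalmx A x)^T.
Proof. by rewrite !pevalmxM pevalmx_constmx /pevalmx map_trmx. Qed.

Lemma sos_ge0 p x : sos p -> 0 <= peval p x.
Proof.
move=> [s ->]; rewrite peval_sum; apply: sumr_ge0 => q _.
by rewrite expr2 pevalM -expr2 sqr_ge0.
Qed.

Lemma peval_prod (I : Type) (r : seq I) (Q : pred I) (F : I -> P) x :
  peval (\prod_(i <- r | Q i) F i) x = \prod_(i <- r | Q i) peval (F i) x.
Proof. exact: rmorph_prod. Qed.

Lemma opD_ge0 k (g : k.-tuple P) s x : (forall nu, sos (s nu)) ->
  semialg g x -> 0 <= peval (opD g s) x.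
Proof.
move=> sos_s gx; rewrite peval_sum; apply: sumr_ge0 => nu _.
rewrite pevalM; apply: mulr_ge0; first exact: sos_ge0.
rewrite peval_prod; apply: prodr_ge0 => i _.
by case: (nu i); rewrite ?expr0 ?expr1 ?gx// [peval 1 x]meval1.
Qed.

(** A point of the zero locus kills one factor [h_i], and the certificate with
    that index then exhibits [p] as a sum of squares at the point. *)
Lemma opB_sos_ge0 m (h : m.-tuple P) p t x :
  opB_sos h p t -> zero_locus h x -> 0 <= peval p x.
Proof.
move=> pt; rewrite /zero_locus/= peval_prod => /eqP /prodf_eq0[i _ /eqP hi0].
by have := sos_ge0 x (pt i); rewrite pevalB pevalM hi0 mulr0 subr0.
Qed.

End Evaluation.

(** * The maximum principle and the logarithmic transform *)

Section Control.
Variables (R : realType) (n k m p r : nat) (C : control_data R n k m p r).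
Local Notation P := (mpoly n R).
Local Notation lambda := (cd_lambda C).
Implicit Types (x : 'cV[R]_n).

Lemma peval_opL (Psi : P) x :
  peval (opL C Psi) x =
    ((pevalmx (cd_f C) x)^T *m pevalmx (pgrad Psi) x) 0 0
    + 2^-1 * \tr (pevalmx (phess Psi) x *m pevalmx (Sigma C) x).
Proof.
rewrite pevalD pevalZ -pevalmxM; congr (_ + _ * _).
  have -> : (pevalmx (cd_f C) x)^T = pevalmx (cd_f C)^T x.
    by rewrite /pevalmx map_trmx.
  by rewrite -pevalmxM [RHS]mxE.
by rewrite peval_sum; apply: eq_bigr => i _; rewrite [RHS]mxE.
Qed.

Lemma psd_Sigma x : psd_mx (cd_Sigma_eps C) -> psd_mx (pevalmx (Sigma C) x).
Proof.
move=> [Ssym Spos]; rewrite /Sigma pevalmx_congruence; split.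
  by rewrite !trmx_mul trmxK Ssym mulmxA.
move=> v; set B := pevalmx _ x.
have := Spos (B^T *m v); rewrite trmx_mul trmxK.
by rewrite !mulmxA.
Qed.

(** A strict maximum principle.  A maximum point other than the origin has value
    less than 1: in the interior it cannot exist, as the first and second order
    conditions contradict [L Psi >= q Psi / lambda > 0], and on the boundary
    the data are less than 1.  Since the origin carries the value 1, it is
    the only maximum point. *)
Lemma subsolution_lt1 (Psi : P) :
  standing_assumptions C ->
  (forall x, Omega C x -> lambda^-1 * peval (cd_q C) x * peval Psi x
                          <= peval (opL C Psi) x) ->
  (forall x, Omega C x -> 0 < peval Psi x) ->
  (forall x, dOmega C x -> peval Psi x <= psi_bd C x) ->
  peval Psi 0 = 1 ->
  forall x, Omega C x -> x != 0 -> peval Psi x < 1.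
Proof.
move=> SA sub Psi_gt0 Psi_bd Psi0 x Ox x0.
have lambda_gt0 := sa_lambda SA.
have [|c] := compact_EVT_max _ (sa_compact SA)
    (continuous_subspaceT (@peval_continuous R n Psi)).
  by exists 0; exact: sa_origin SA.
rewrite inE => Oc max_in.
have {}max_in y : Omega C y -> peval Psi y <= peval Psi c.
  by move=> Oy; apply: max_in; rewrite inE.
have max_lt1 y : Omega C y -> y != 0 -> peval Psi y = peval Psi c ->
    peval Psi y < 1.
  move=> Oy y0 yc; have [yint|ynint] := pselect (interior (Omega C) y).
    have [grad0 hess_le0] : pevalmx (pgrad Psi) y = 0 /\ forall v : 'cV[R]_n,
        (v^T *m pevalmx (phess Psi) y *m v) 0 0 <= 0.
      by apply: peval_local_max yint _ => z Oz; rewrite yc; exact: max_in.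
    have : 0 <= \tr (- pevalmx (phess Psi) y *m pevalmx (Sigma C) y).
      apply: mxtrace_mul_psd_ge0; last exact: psd_Sigma (sa_Sigma_eps SA).
      by move=> v; rewrite mulmxN mulNmx mxE oppr_ge0.
    rewrite mulNmx linearN/= oppr_ge0 => tr_le0.
    have := sub y Oy; rewrite peval_opL grad0 mulmx0 mxE add0r => qPsi.
    have q_gt0 : 0 < peval (cd_q C) y by case: (sa_q_pd SA) => _; apply.
    have : 0 < lambda^-1 * peval (cd_q C) y * peval Psi y.
      by rewrite !mulr_gt0 ?invr_gt0 ?Psi_gt0.
    lra.
  have dy : dOmega C y.
    have : topo_boundary (Omega C) y by split=> //; exact: subset_closure.
    by case: (sa_boundary SA) => -> //; left.
  apply: le_lt_trans (Psi_bd y dy) _; rewrite /psi_bd expR_lt1 oppr_lt0.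
  by rewrite divr_gt0// (sa_phi_boundary SA).
have c_le1 : peval Psi c <= 1.
  have [->|c0] := eqVneq c 0; first by rewrite Psi0.
  by apply/ltW/max_lt1.
have [xc|xc] := eqVneq (peval Psi x) (peval Psi c); first exact: max_lt1.
by apply: lt_le_trans c_le1; rewrite lt_neqAle xc max_in.
Qed.

(** Half of the minimizing feedback [- R^-1 G^T grad V] of the HJB equation.
    With the factor 1/2 its contribution to the generator is the quadratic term
    [- 1/2 (grad V)^T G R^-1 G^T grad V] of that equation, with no remainder. *)
Definition log_feedback (V : 'cV[R]_n -> R) x (t : R) : 'cV[R]_p :=
  - 2^-1 *: (invmx (cd_R C) *m (pevalmx (cd_G C) x)^T *m gradient V x).

(** In [V = - lambda ln Psi] the second derivative of the logarithm contributes
    [lambda / (2 Psi^2) g^T Sigma g] with [g = grad Psi], and the feedback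
    contributes the opposite, because [G R^-1 G^T = Sigma / lambda]. *)
Lemma generator_log_transform (Psi : P) x (t : R) :
  standing_assumptions C -> 0 < peval Psi x ->
  let V := fun y : 'cV[R]_n => - lambda * ln (peval Psi y) in
  generator C (log_feedback V) (fun y _ => V y) x t
    = - (lambda / peval Psi x) * peval (opL C Psi) x.
Proof.
move=> SA Psi_gt0 V.
have lambda0 : lambda != 0 by rewrite gt_eqF// (sa_lambda SA).
have Psi0 : peval Psi x != 0 by rewrite gt_eqF.
set a := peval Psi x in Psi0 *.
set g := pevalmx (pgrad Psi) x; set H := pevalmx (phess Psi) x.
set S := pevalmx (Sigma C) x.
have gradE : gradient V x = - (lambda / a) *: g.
  apply/colP => i; rewrite !mxE partial_ln_peval// -/a; field.
  exact: Psi0.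
have hessE : hessian V x
    = - (lambda / a) *: H + (lambda / a ^+ 2) *: (g *m g^T).
  apply/matrixP => i j; rewrite !mxE big_ord1.
  rewrite partial_partial_ln_peval// !mxE -/a.
  by field.
have Gu : pevalmx (cd_G C) x *m log_feedback V x t = (2 * a)^-1 *: (S *m g).
  rewrite /log_feedback -scalemxAr !mulmxA -pevalmx_congruence gradE -scalemxAr.
  rewrite /S -(sa_noise SA) -/(GRG C) -scalemxAl !scalerA; congr (_ *: _).
  by field; exact: Psi0.
have -> : generator C (log_feedback V) (fun y _ => V y) x t
    = ((gradient V x)^T *m (pevalmx (cd_f C) x
                            + pevalmx (cd_G C) x *m log_feedback V x t)) 0 0
      + 2^-1 * \tr (hessian V x *m S).
  by rewrite /generator /time_derivative (derive1_cst (V x)) add0r.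
rewrite Gu gradE hessE peval_opL -/g -/H -/S.
rewrite mulmxDl mxtraceD -!scalemxAl !mxtraceZ.
rewrite linearZ/= -scalemxAl mulmxDr -scalemxAr mulmxA.
have -> : \tr (g *m g^T *m S) = (g^T *m S *m g) 0 0.
  by rewrite -mulmxA mxtrace_mulC /mxtrace big_ord1.
have -> : ((pevalmx (cd_f C) x)^T *m g) 0 0 = (g^T *m pevalmx (cd_f C) x) 0 0.
  by rewrite -tr_mx11 trmx_mul trmxK.
move: (g^T *m _ *m _) (g^T *m _) => X Y; rewrite !mxE.
by field.
Qed.

End Control.

(** * The Lyapunov function of the sum of squares program *)

Theorem theorem4p6 (R : realType) (n k m p r d : nat)
    (C : control_data R n k m p r) (s : sos_variables R n k m) :
  standing_assumptions C ->
  sos_solution C d s ->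
  (forall x : 'cV[R]_n, Omega C x -> 0 < peval (Psi_l s) x) ->
  is_SCLF C (fun x _ => V_u C s x).
Proof.
move=> SA [feas _] Psi_gt0.
have lambda_gt0 := sa_lambda SA.
have sub x : Omega C x ->
    (cd_lambda C)^-1 * peval (cd_q C) x * peval (Psi_l s) x
    <= peval (opL C (Psi_l s)) x.
  move=> Ox; have := sos_ge0 x (sf_lower feas).
  have := opD_ge0 (fun nu => (sf_S1 feas nu).1) Ox.
  rewrite !pevalB pevalD pevalN pevalZ pevalM; lra.
have bd x : dOmega C x -> peval (Psi_l s) x <= psi_bd C x.
  move=> dx; have := opB_sos_ge0 (sf_bd_lower feas) dx.
  by rewrite pevalB subr_ge0 (sa_psi SA).
have Psi_lt1 := subsolution_lt1 SA sub Psi_gt0 bd (sf_origin feas).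
have V_pd : pd_fun_on (Omega C) (V_u C s).
  split; first by rewrite /V_u (sf_origin feas) ln1 mulr0.
  move=> x Ox x0; rewrite /V_u mulNr oppr_gt0 pmulr_rlt0// ln_lt0//.
  by rewrite Psi_gt0// Psi_lt1.
split=> //.
- have [U [oU PU] UC] := C21_on_ln_peval (Psi_l s) (- cd_lambda C).
  by exists U => //; split=> // x Ox; apply: PU; exact: Psi_gt0.
- have cV : {within Omega C, continuous (V_u C s)}.
    apply: continuous_in_subspaceT => x; rewrite inE => Ox.
    have -> : V_u C s = cst (- cd_lambda C) \* (@ln R \o peval (Psi_l s)) by [].
    apply: continuousM; first exact: cst_continuous.
    apply: continuous_comp; first exact: peval_continuous.
    exact/continuous_ln/Psi_gt0.
  have [mu muK muV] := class_K_minorant (sa_compact SA) (sa_origin SA) cV V_pd.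
  by exists mu => // x t Ox _; exact: muV.
- exists (log_feedback C (V_u C s)) => x t Ox _ _.
  have -> := generator_log_transform t SA (Psi_gt0 x Ox).
  rewrite mulNr oppr_le0; apply: mulr_ge0.
    by rewrite ltW// divr_gt0// Psi_gt0.
  apply: le_trans (sub x Ox).
  by rewrite !mulr_ge0 ?invr_ge0 ?(ltW lambda_gt0) ?(sa_q_ge0 SA) ?ltW ?Psi_gt0.
Qed.
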